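(* Let $\mathbb F_q$ be a finite field of characteristic $p$ with $q=p^s$ elements, let $n\ge2$, let $b\in\mathbb F_q^*$ and let $k,k_1,\dots,k_n,m_1,\dots,m_n$ be positive integers. Let $N_q$ be the number of solutions $(x_1,\dots,x_n)\in\mathbb F_q^n$ of $$(x_1^{m_1}+\dots+x_n^{m_n})^k=bx_1^{k_1}\cdots x_n^{k_n}.$$ Let $d_j=\gcd(m_j,q-1)$, $D=\mathrm{lcm}[d_1,\dots,d_n]$ and $k_0=\gcd(k,k_1,\dots,k_n,q-1)$. Assume that $b$ is not a $k_0$th power in $\mathbb F_q$, that $D>2$, and that there exists a positive integer $\ell$ with $D\mid p^\ell+1$; let $\ell$ be the minimal such integer. Then $2\ell\mid s$ and $$N_q=q^{n-1}-\frac{(q-1)^n+(-1)^n(q-1)}{q}-(-1)^n(q-1)\sum_{r=2}^{n-1}(-1)^{rs/2\ell}q^{(r-2)/2}\sum_{1\le j_1<\dots<j_r\le n}I(d_{j_1},\dots,d_{j_r}).$$ In particular, if $d_1=\dots=d_n=D$, then $$N_q=q^{n-1}-\frac{(q-1)^n+(-1)^n(q-1)}{q}-(-1)^n(q-1)\sum_{r=2}^{n-1}(-1)^{rs/2\ell}q^{(r-2)/2}\binom nr\frac{(D-1)^r+(-1)^r(D-1)}{D}.$$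
   Context: For positive integers $v_1,\dots,v_r$, $I(v_1,\dots,v_r)$ denotes the number of $r$-tuples $(j_1,\dots,j_r)$ of integers with $1\le j_i\le v_i-1$ for all $i$ such that $j_1/v_1+\dots+j_r/v_r$ is an integer. *)

(* Defs.v *)
From HB Require Import structures.
From mathcomp Require Import all_boot all_order all_algebra all_field.
Set Implicit Arguments. Unset Strict Implicit. Unset Printing Implicit Defensive.
Import Order.TTheory GRing.Theory Num.Theory.
Local Open Scope ring_scope.

(* I(v_1,...,v_r): number of tuples (j_1,...,j_r) with 1 <= j_i <= v_i - 1
   such that j_1/v_1 + ... + j_r/v_r is an integer.  The j_i are taken in
   'I_(\max v) which is harmless since j_i <= v_i - 1 < \max v. *)
Definition Icount (v : seq nat) : nat :=
  #|[set j : {ffun 'I_(size v) -> 'I_(\max_(x <- v) x)} |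
      [forall i : 'I_(size v), (1 <= j i)%N && (j i <= (nth 0%N v i).-1)%N]
      && ((\sum_(i < size v) ((j i)%:R / (nth 0%N v i)%:R : rat)) \is a Num.int)]|.

Definition Nsol (F : finFieldType) (n : nat) (b : F) (k : nat)
    (kk mm : 'I_n -> nat) : nat :=
  #|[set x : {ffun 'I_n -> F} |
      (\sum_(i < n) x i ^+ mm i) ^+ k == b * \prod_(i < n) x i ^+ kk i]|.

(* Main.v *)
Require Import Defs.
From HB Require Import structures.
From mathcomp Require Import all_boot all_order all_algebra all_field.
From mathcomp Require Import all_fingroup all_solvable all_character ring zify.
Import Order.TTheory GRing.Theory Num.Theory.
Local Open Scope ring_scope.
Set Implicit Arguments. Unset Strict Implicit. Unset Printing Implicit Defensive.

(** Since [b] is not a [k0]-th power, every solution has a vanishing coordinate,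
    so [N_q] is the number of zeros of [x_1^m_1 + ... + x_n^m_n] minus the number
    of its zeros with all coordinates nonzero.  Both are sums over [a] of products
    of the power sums [sum_x psi (a x^m)], [psi] a nontrivial additive character,
    and [m_j] may be replaced by [d_j] there.  With [Q = p^l], [|F| = Q^(2g)] and
    [d | Q + 1], the power sum is [(-Q)^g (1 - d)] or [(-Q)^g], according to whether
    [a / c] is or is not a [d]-th power, for one [c] that does not depend on [d].
    So after the substitution [a = c t] only products of [d [t is a d-th power] - 1]
    remain, and their sums over [t] are [(q - 1) I(d_j1, ..., d_jr)].  In the
    difference of the two counts the term of the full index set cancels.

    The power sum is computed without Gauss sums.  For [d = Q + 1] its square is
    [|F|] times the number of roots of [a^Q u^(Q^2) + a u], namely [1] or [Q^2], and
    its sign is then forced by its being [1] modulo [Q + 1].  For other [d] one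
    averages over the substitutions [x -> x w^((Q + 1) / d)]. *)

(** * Power maps on finite fields *)

(** In ['Z_D] the powers [p ^ l] and [p ^ s] are [-1] and [1]. Dividing, [s = u l + v] with [v < l],
    gives [(-1) ^ u p ^ v = 1]. If [v > 0], then [p ^ v] or [p ^ (l - v)] is [-1], against
    minimality; if [v = 0], then [u] is even, as [-1 != 1] for [D > 2]. *)
Lemma double_dvdn_of_min_exp (p s l D : nat) : (2 < D)%N -> (0 < l)%N ->
  (D %| p ^ l + 1)%N ->
  (forall l', (0 < l')%N -> (D %| p ^ l' + 1)%N -> (l <= l')%N) ->
  (D %| (p ^ s).-1)%N -> (2 * l %| s)%N.
Proof.
move=> D2 l0 Dl minl Ds; have D1 : (1 < D)%N by apply: ltn_trans D2.
have natZ0 m : (m%:R == 0 :> 'Z_D) = (D %| m)%N.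
  by rewrite -val_eqE /= val_Zp_nat.
have Xl : (p%:R : 'Z_D) ^+ l = -1.
  by apply/eqP; rewrite -addr_eq0 -natrX natr1 natZ0 -addn1.
have p0 : (0 < p)%N.
  case: (posnP p) => // p0; move: Dl.
  by rewrite p0 exp0n // dvdn1 => /eqP D1'; rewrite D1' in D2.
have Xs : (p%:R : 'Z_D) ^+ s = 1.
  apply/eqP; rewrite -subr_eq0 -natrX -[(p ^ s)%N]prednK ?expn_gt0 ?p0 //.
  by rewrite -natr1 addrK natZ0.
have N1 : (-1 : 'Z_D) != 1.
  by rewrite eq_sym -subr_eq0 opprK -(natrD _ 1 1) natZ0; apply/negP => /dvdn_leq; lia.
have noX v : (0 < v < l)%N -> (p%:R : 'Z_D) ^+ v != -1.
  move=> /andP[v0 vl]; apply/eqP => Xv.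
  suff /minl : (D %| p ^ v + 1)%N by move/(_ v0); lia.
  by rewrite -natZ0 addn1 -natr1 natrX Xv addNr.
have := divn_eq s l; set u := (s %/ l)%N; set v := (s %% l)%N => sE.
have vl : (v < l)%N by rewrite ltn_mod.
have E : (-1) ^+ u * (p%:R : 'Z_D) ^+ v = 1.
  by rewrite -Xl -exprM mulnC -exprD -sE.
case v0 : v => [|v'].
  rewrite sE v0 addn0 dvdn_pmul2r // dvdn2; apply/negP => uodd.
  by move: E; rewrite v0 mulr1 -signr_odd uodd expr1 => /eqP; apply/negP.
case uodd : (odd u).
  move: E; rewrite -signr_odd uodd expr1 mulN1r => /eqP; rewrite eqr_oppLR.
  by apply: contraTT => _; apply: noX; lia.
move: E; rewrite -signr_odd uodd expr0 mul1r => E.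
have : (p%:R : 'Z_D) ^+ (l - v) == -1.
  by rewrite -Xl -{2}(subnK (ltnW vl)) exprD E mulr1.
by apply: contraTT => _; apply: noX; lia.
Qed.

Lemma finField_expf_pred (F : finFieldType) (x : F) :
  x != 0 -> x ^+ #|F|.-1 = 1.
Proof.
move=> x0; apply: (mulfI x0); rewrite mulr1 -exprS prednK ?expf_card //.
by apply/card_gt0P; exists 0.
Qed.

Lemma finField_card_nz (F : finFieldType) : #|[pred x : F | x != 0]| = #|F|.-1.
Proof. by rewrite -(cardC1 (0 : F)); apply: eq_card => x; rewrite !inE. Qed.

Lemma finField_prim_root (F : finFieldType) :
  exists z : F, (#|F|.-1).-primitive_root z.
Proof.
have q0 : (0 < #|F|.-1)%N.
  by have := finNzRing_gt1 F; case: #|F| => [|[|]].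
have /hasP[z _ zP] : has (#|F|.-1).-primitive_root (enum [pred x : F | x != 0]).
  apply: cyclic.has_prim_root => //; last by rewrite -cardE finField_card_nz.
    apply/allP => x; rewrite mem_enum inE => x0.
    by apply/unity_rootP; apply: finField_expf_pred.
  exact: enum_uniq.
by exists z.
Qed.

(** For [t = z ^ i] with [z] a generator, the hypothesis makes [#|F| - 1] divide [i (#|F| - 1) / m],
    so [m] divides [i]. *)
Lemma finField_power (F : finFieldType) (m : nat) (t : F) : t != 0 ->
  (m %| #|F|.-1)%N -> t ^+ (#|F|.-1 %/ m) = 1 -> exists y, y ^+ m = t.
Proof.
move=> t0 /dvdnP[e eE] t1; have [z zP] := finField_prim_root F.
have q0 := prim_order_gt0 zP.
have [[i /= _] tE] := prim_rootP zP (finField_expf_pred t0).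
have m0 : (0 < m)%N by move: q0; rewrite eE muln_gt0 => /andP[].
move/eqP: t1; rewrite tE -exprM -(prim_order_dvd zP) {1}eE eE mulnK // mulnC.
have e0 : (0 < e)%N by move: q0; rewrite eE muln_gt0 => /andP[].
rewrite dvdn_pmul2r // => /dvdnP[j iE].
by exists (z ^+ j); rewrite -exprM -iE.
Qed.

Lemma sum_unity_root (F : finFieldType) (V : nmodType) (N : nat) (w : F)
    (f : F -> V) : N.-primitive_root w ->
  \sum_(t | t ^+ N == 1) f t = \sum_(k < N) f (w ^+ k).
Proof.
move=> wP; rewrite -big_enum -(big_map (fun k : 'I_N => w ^+ k) xpredT f).
apply: perm_big; apply: uniq_perm; first exact: enum_uniq.
  rewrite map_inj_uniq ?index_enum_uniq // => i j /eqP.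
  by rewrite (eq_prim_root_expr wP) !modn_small // => /eqP/val_inj.
move=> t; rewrite mem_enum; apply/idP/mapP => [/eqP tN | [k _ ->]].
  by have [i ->] := prim_rootP wP tN; exists i; rewrite ?mem_index_enum.
by apply/eqP; rewrite exprAC (prim_expr_order wP) expr1n.
Qed.

Lemma finField_nz_unity (F : finFieldType) (t : F) :
  (t != 0) = (t ^+ #|F|.-1 == 1).
Proof.
have [z zP] := finField_prim_root F.
case: (eqVneq t 0) => [-> | t0]; last by rewrite finField_expf_pred ?eqxx.
by rewrite expr0n gtn_eqF ?(prim_order_gt0 zP) // eq_sym oner_eq0.
Qed.

Lemma finField_count_unity (F : finFieldType) (N : nat) :
  (N %| #|F|.-1)%N -> #|[pred t : F | t ^+ N == 1]| = N.
Proof.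
move=> Nq; have [z zP] := finField_prim_root F.
rewrite -sum1_card (sum_unity_root (fun _ => 1%N) (dvdn_prim_root zP Nq)).
by rewrite sum1_card card_ord.
Qed.

Lemma finField_power_gcd (F : finFieldType) (m : nat) (t : F) : (0 < m)%N ->
  t != 0 -> t ^+ (#|F|.-1 %/ gcdn m #|F|.-1) = 1 -> exists y, y ^+ m = t.
Proof.
(* The Bezout coefficient of [m] turns a root of exponent [gcdn m #|F|.-1] into one of exponent
   [m]. *)
move=> m0 t0 /(finField_power t0 (dvdn_gcdr _ _))[y yt]; exists (y ^+ (egcdn m #|F|.-1).1).
have y0 : y != 0.
  by apply: contraNneq t0 => y0; rewrite -yt y0 expr0n gtn_eqF // gcdn_gt0 m0.
rewrite -exprM; case: egcdnP => // u v /= -> _.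
by rewrite exprD mulnC exprM finField_expf_pred // expr1n mul1r.
Qed.

Lemma finField_count_unity_gcd (F : finFieldType) (m : nat) : (0 < m)%N ->
  #|[pred t : F | t ^+ m == 1]| = gcdn m #|F|.-1.
Proof.
move=> m0; rewrite -(finField_count_unity (dvdn_gcdr m #|F|.-1)).
apply: eq_card => t; rewrite !inE; apply/eqP/eqP => [tm | tg].
  have t0 : t != 0.
    apply/eqP => t0; move/eqP: tm.
    by rewrite t0 expr0n gtn_eqF // eq_sym oner_eq0.
  case: (egcdnP #|F|.-1 m0) => u v uE _.
  have : t ^+ (u * m) = 1 by rewrite mulnC exprM tm expr1n.
  by rewrite uE exprD mulnC exprM finField_expf_pred // expr1n mul1r.
by rewrite -(divnK (dvdn_gcdl m #|F|.-1)) mulnC exprM tg expr1n.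
Qed.

(** Each nonempty fibre of [x -> x ^ m] on nonzero elements is a coset of the group of [m]-th roots
    of unity. *)
Lemma sum_power_fibers (F : finFieldType) (V : nmodType) (m : nat) (f : F -> V) :
  (0 < m)%N ->
  \sum_(x | x != 0) f (x ^+ m) =
  (\sum_(y | (y != 0) && (y ^+ (#|F|.-1 %/ gcdn m #|F|.-1) == 1)) f y)
    *+ gcdn m #|F|.-1.
Proof.
move=> m0; set e := (_ %/ _)%N; pose P (y : F) := (y != 0) && (y ^+ e == 1).
have imP x : x != 0 -> P (x ^+ m).
  move=> x0; rewrite /P expf_neq0 //= -exprM -(divnK (dvdn_gcdl m #|F|.-1)) -mulnA.
  by rewrite [(_ * e)%N]mulnC divnK ?dvdn_gcdr // mulnC exprM finField_expf_pred ?expr1n.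
rewrite (partition_big (fun x => x ^+ m) P) //=.
rewrite -sumrMnl; apply: eq_bigr => y /andP[y0 /eqP yP].
under eq_bigr => x /andP[_ /eqP ->] do over.
rewrite sumr_const; congr (_ *+ _).
have [x0 x0P] := finField_power_gcd m0 y0 yP.
have x0n0 : x0 != 0.
  by apply: contraNneq y0 => x00; rewrite -x0P x00 expr0n gtn_eqF.
rewrite -[RHS](finField_count_unity_gcd F m0) -!sum1_card [LHS](reindex_inj (mulfI x0n0)).
apply: eq_bigl => t.
rewrite inE -[_ \in _]/((x0 * t != 0) && ((x0 * t) ^+ m == y)) exprMn x0P.
rewrite mulf_eq0 (negPf x0n0) /= -[X in _ * _ == X]mulr1 (inj_eq (mulfI y0)).
by case: (eqVneq t 0) => // ->; rewrite expr0n gtn_eqF // eq_sym oner_eq0.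
Qed.

Lemma sum_power_gcd (F : finFieldType) (V : nmodType) (m : nat) (f : F -> V) :
  (0 < m)%N ->
  \sum_(x | x != 0) f (x ^+ m) = \sum_(x | x != 0) f (x ^+ gcdn m #|F|.-1).
Proof.
move=> m0; have g0 : (0 < gcdn m #|F|.-1)%N by rewrite gcdn_gt0 m0.
by rewrite !sum_power_fibers // (gcdn_idPl (dvdn_gcdr m #|F|.-1)).
Qed.

Lemma exprpXD (F : fieldType) (p i : nat) (x y : F) : p \in [pchar F] ->
  (x + y) ^+ (p ^ i) = x ^+ (p ^ i) + y ^+ (p ^ i).
Proof.
by move=> pF; rewrite exprDn_pchar // pnatX pnatE ?(pcharf_prime pF) // pF.
Qed.

Lemma exprpXN (F : fieldType) (p i : nat) (x : F) : p \in [pchar F] ->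
  (- x) ^+ (p ^ i) = - x ^+ (p ^ i).
Proof.
move=> pF; apply/eqP; rewrite -addr_eq0 -(exprpXD _ _ _ pF) addNr expr0n gtn_eqF //.
by rewrite expn_gt0 prime_gt0 // (pcharf_prime pF).
Qed.

(** * Additive characters *)

(** The irreducible characters of the additive group have trivial common kernel, and they are linear
    because the group is abelian. *)
Lemma exists_add_char (F : finFieldType) (x : F) : x != 0 ->
  exists psi : F -> algC,
    [/\ {morph psi : y z / y + z >-> y * z}, psi 0 = 1 & psi x != 1].
Proof.
move=> x0; have := TI_cfker_irr [set: F]%G.
move/setP/(_ x); rewrite inE (negPf x0) => xN.
have [i xi] : exists i : Iirr [set: F]%G, x \notin cfker 'chi_i.
  apply/existsP; rewrite -negb_forall; apply/negP => /forallP xi.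
  by move: xN; rewrite (introT bigcapP) // => i _; apply: xi.
have lini : 'chi_i \is a linear_char.
  by apply/char_abelianP; apply: FinRing.zmod_abelian.
exists 'chi_i; split.
- by move=> y z; rewrite -FinRing.zmodMgE lin_charM ?inE.
- exact: lin_char1.
by move: xi; rewrite cfkerEirr inE (lin_char1 lini).
Qed.

Section AdditiveCharacter.

Variables (F : finFieldType) (psi : F -> algC).
Hypothesis psiD : {morph psi : y z / y + z >-> y * z}.
Hypothesis psi0 : psi 0 = 1.
Hypothesis psi_nontriv : exists x, psi x != 1.

Lemma psi_sum (I : Type) (r : seq I) (P : pred I) (f : I -> F) :
  psi (\sum_(i <- r | P i) f i) = \prod_(i <- r | P i) psi (f i).
Proof. exact: (big_morph psi psiD psi0). Qed.

(** The value is a [p]-th root of unity, [p] being the characteristic. *)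
Lemma psi_Aint y : psi y \in Aint.
Proof.
have psiMn n : psi (y *+ n) = psi y ^+ n.
  by elim: n => [|n IH]; rewrite ?mulr0n ?expr0 // mulrS exprS psiD IH.
have [p pr_p /dvdn_pcharf/(_ p)] := finPcharP F; rewrite dvdnn => /esym/eqP p0.
apply: (Aint_unity_root (prime_gt0 pr_p)); apply/unity_rootP.
by rewrite -psiMn -mulr_natr p0 mulr0.
Qed.

Lemma psi_orthogonality (a : F) :
  \sum_y psi (a * y) = if a == 0 then (#|F|)%:R else 0.
Proof.
case: eqP => [-> | /eqP a0].
  under eq_bigr do rewrite mul0r psi0.
  by rewrite sumr_const.
have [x xN1] := psi_nontriv.
transitivity (\sum_y psi y); first by rewrite [RHS](reindex_inj (mulfI a0)).
have : psi x * \sum_y psi y = \sum_y psi y.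
  rewrite big_distrr [RHS](reindex_inj (addrI x)) /=.
  by apply: eq_bigr => y _; rewrite psiD.
move/eqP; rewrite -subr_eq0 -[X in _ - X]mul1r -mulrBl mulf_eq0 subr_eq0.
by rewrite (negPf xN1) => /eqP.
Qed.

Definition powersum (d : nat) (a : F) : algC := \sum_x psi (a * x ^+ d).

Lemma powersum0 d : powersum d 0 = (#|F|)%:R.
Proof. by rewrite /powersum; under eq_bigr do rewrite mul0r psi0; rewrite sumr_const. Qed.

Lemma powersum_nz d a : (0 < d)%N ->
  powersum d a = 1 + \sum_(x | x != 0) psi (a * x ^+ d).
Proof.
by move=> d0; rewrite /powersum (bigD1 0) //= expr0n gtn_eqF // mulr0 psi0.
Qed.

End AdditiveCharacter.

(** * Power sums in the semiprimitive case *)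

(** This fixes a sign by a congruence: [x = - y] would make [2 / m] a rational algebraic integer,
    hence an integer, which [m > 2] excludes. *)
Lemma Aint_eq_of_sqr_eq (m : nat) (x y A B : algC) : (2 < m)%N ->
  A \in Aint -> B \in Aint -> x = 1 + m%:R * A -> y = 1 + m%:R * B ->
  x ^+ 2 = y ^+ 2 -> x = y.
Proof.
move=> m2 AA BA xE yE /eqP; rewrite eqf_sqr => /orP[/eqP // | /eqP xNy].
have m0 : (m%:R : algC) != 0 by rewrite pnatr_eq0; lia.
have E : - (A + B) = 2%:R / m%:R.
  apply: (mulIf m0); rewrite divfK //.
  have : x + y = 0 by rewrite xNy addNr.
  rewrite xE yE => H; apply/eqP; rewrite -subr_eq0; apply/eqP.
  by rewrite -[RHS]oppr0 -H; ring.
have : - (A + B) \is a Num.int.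
  apply: Cint_rat_Aint; last by rewrite rpredN rpredD.
  by rewrite E rpred_div ?rpred_nat.
rewrite E => /intrP[z /eqP]; rewrite (can2_eq (divfK m0) (mulfK m0)) => /eqP zE.
have {zE} : (2 : int) = z * m%:R :> int.
  by apply: (@intr_inj algC); rewrite rmorphM /= !rmorph_nat -zE.
rewrite !natz => zE; have /dvdn_leq : (m %| 2)%N.
  by apply/dvdnP; exists `|z|%N; rewrite -[LHS]/(`|Posz 2|%N) zE abszM.
by move=> /(_ isT); rewrite leqNgt m2.
Qed.

Lemma oppX_congr1 (Q g : nat) :
  exists2 B : algC, B \in Aint & (- Q%:R) ^+ g = 1 + (Q.+1)%:R * B.
Proof.
elim: g => [|g [B BA E]]; first by exists 0; rewrite ?rpred0 // expr0 mulr0 addr0.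
exists (- 1 - Q%:R * B); first by rewrite rpredB ?rpredN ?rpred1 ?rpredM ?rpred_nat.
by rewrite exprS E -natr1; ring.
Qed.

Section Semiprimitive.

Variables (F : finFieldType) (p l g Q : nat).
Hypothesis pchF : p \in [pchar F].
Hypothesis l_gt0 : (0 < l)%N.
Hypothesis QE : Q = (p ^ l)%N.
Hypothesis cardF : #|F| = (Q ^ (2 * g))%N.

Let p_prime : prime p. Proof. exact: pcharf_prime pchF. Qed.

Let Q_gt1 : (1 < Q)%N.
Proof. by rewrite QE -(exp1n l) ltn_exp2r // prime_gt1. Qed.

Let Q_gt0 : (0 < Q)%N. Proof. exact: ltnW. Qed.

Let Qm1_gt0 : (0 < Q.-1)%N. Proof. by rewrite -ltnS prednK. Qed.

Let Q2_gt0 : (0 < Q ^ 2)%N. Proof. by rewrite expn_gt0 Q_gt0. Qed.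

Lemma frobD (x y : F) : (x + y) ^+ Q = x ^+ Q + y ^+ Q.
Proof. by rewrite QE (exprpXD _ _ _ pchF). Qed.

Lemma frobN (x : F) : (- x) ^+ Q = - x ^+ Q.
Proof. by rewrite QE (exprpXN _ _ pchF). Qed.

Let q1E : #|F|.-1 = (Q.-1 * (Q.+1 * \sum_(i < g) (Q ^ 2) ^ i))%N.
Proof.
rewrite cardF expnM predn_exp mulnA; congr (_ * _)%N.
by rewrite predn_exp !big_ord_recl big_ord0 expn0 expn1 addn0 add1n.
Qed.

Lemma dvdn_succQ : (Q.+1 %| #|F|.-1)%N.
Proof. by rewrite q1E dvdn_mull ?dvdn_mulr. Qed.

Let dvdn_predQ : (Q.-1 %| #|F|.-1)%N.
Proof. by rewrite q1E dvdn_mulr. Qed.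

Let dvdn_sqrQ : ((Q ^ 2).-1 %| #|F|.-1)%N.
Proof. by rewrite cardF expnM [X in (_ %| X)%N]predn_exp dvdn_mulr. Qed.

Let q1_divS : (#|F|.-1 %/ Q.+1 = Q.-1 * \sum_(i < g) (Q ^ 2) ^ i)%N.
Proof. by rewrite q1E mulnA [(Q.-1 * _)%N]mulnC -mulnA mulKn. Qed.

(** This supplies the constant [c] of the power sums. The cofactor of [Q - 1] in [#|F| - 1] is a
    multiple of [Q + 1], so [-1] passes the test for being a [(Q - 1)]-th power, in characteristic 2
    as well. *)
Lemma exists_frob_opp : exists2 c : F, c != 0 & c ^+ Q = - c.
Proof.
have NQ : (-1 : F) ^+ Q.+1 = 1 by rewrite exprS frobN expr1n mulrNN mulr1.
have [||c cP] := @finField_power F Q.-1 (-1) _ dvdn_predQ.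
- by rewrite oppr_eq0 oner_eq0.
- by rewrite q1E mulKn // exprM NQ expr1n.
exists c; last by rewrite -(prednK Q_gt0) exprS cP mulrN1.
apply/eqP => c0; move: cP; rewrite c0 expr0n gtn_eqF // => /eqP.
by rewrite eq_sym oppr_eq0 oner_eq0.
Qed.

(** Substituting [u x] for [x] then shows that the power sum of exponent [Q + 1] is even in [a]. *)
Lemma exists_norm_opp : exists2 u : F, u != 0 & u ^+ Q.+1 = -1.
Proof.
have N1 : (-1 : F) != 0 by rewrite oppr_eq0 oner_eq0.
have NQ : (-1 : F) ^+ Q.-1 = 1.
  apply: (mulIf N1); rewrite mul1r -exprSr prednK //.
  by rewrite frobN expr1n.
have [|u uP] := @finField_power F Q.+1 (-1) N1 dvdn_succQ.
  by rewrite q1_divS exprM NQ expr1n.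
exists u => //; apply: contraNneq N1 => u0.
by rewrite -uP u0 expr0n.
Qed.

Lemma card_fixed_sqr : #|[pred v : F | v ^+ (Q ^ 2) == v]| = (Q ^ 2)%N.
Proof.
have Q2 : (0 < (Q ^ 2).-1)%N by rewrite -ltnS prednK // -[1%N](expn0 Q) ltn_exp2l.
rewrite (cardD1 0) inE expr0n (gtn_eqF Q2_gt0) eqxx -[RHS](prednK Q2_gt0).
rewrite -[in RHS](finField_count_unity dvdn_sqrQ) add1n; congr _.+1.
apply: eq_card => v; rewrite !inE -[X in v ^+ X == v](prednK Q2_gt0).
rewrite exprSr; case: (eqVneq v 0) => [->|v0] /=.
  by rewrite expr0n gtn_eqF // eq_sym oner_eq0.
by rewrite -[X in _ == X]mul1r (inj_eq (mulIf v0)).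
Qed.

Variable psi : F -> algC.
Hypothesis psiD : {morph psi : y z / y + z >-> y * z}.
Hypothesis psi0 : psi 0 = 1.
Hypothesis psi_nontriv : exists x, psi x != 1.
(** This and the next hypothesis hold for a character that factors through the absolute trace; see
    [exists_trace_char]. *)
Hypothesis psi_frob : forall x, psi (x ^+ Q) = psi x.
Hypothesis psi_trace0 : forall x, x ^+ Q = - x -> psi x = 1.

Local Notation G := (powersum psi Q.+1).

Lemma frob_opp_of_root (a u : F) : a ^+ Q * u ^+ (Q ^ 2) + a * u = 0 ->
  (a * u ^+ Q.+1) ^+ Q = - (a * u ^+ Q.+1).
Proof.
move/eqP; rewrite addr_eq0 => /eqP uP.
by rewrite exprMn -exprM mulSn mulnn exprD mulrCA uP exprSr; ring.
Qed.

Let G_opp a : G (- a) = G a.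
Proof.
have [u u0 uP] := exists_norm_opp.
rewrite /powersum [RHS](reindex_inj (mulfI u0)); apply: eq_bigr => x _ /=.
by rewrite exprMn uP mulN1r mulNr mulrN.
Qed.

(** Write the square as [G a * G (- a)] and put [x = y + u] in the double sum. The argument of [psi]
    becomes [a u ^ (Q + 1)] plus terms that amount to a linear form in [y ^ Q]; orthogonality keeps
    the [u] killing that form, and there [psi (a u ^ (Q + 1)) = 1] by [psi_trace0]. *)
Let G_sqr a : G a ^+ 2 =
  (#|F| * #|[pred u : F | a ^+ Q * u ^+ (Q ^ 2) + a * u == 0]|)%:R.
Proof.
have frob_inj : injective (fun x : F => x ^+ Q).
  move=> x y /= xy; apply/eqP; rewrite -subr_eq0.
  have : (x - y) ^+ Q == 0 by rewrite frobD frobN xy subrr.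
  by rewrite expf_eq0 => /andP[].
rewrite expr2 -{2}G_opp /powersum big_distrlr exchange_big /=.
under eq_bigr => y _ do rewrite (reindex_inj (addrI y)) /=.
rewrite exchange_big /=.
transitivity (\sum_u psi (a * u ^+ Q.+1) *
   \sum_y psi ((a ^+ Q * u ^+ (Q ^ 2) + a * u) * y)).
  apply: eq_bigr => u _; rewrite big_distrr [RHS](reindex_inj frob_inj) /=.
  apply: eq_bigr => y _; rewrite -[in RHS]psiD -psiD.
  have -> : a * (y + u) ^+ Q.+1 + - a * y ^+ Q.+1 =
      a * u ^+ Q.+1 + (a * u * y ^+ Q) + a * u ^+ Q * y.
    by rewrite !exprS frobD; ring.
  (* Frobenius invariance turns the part linear in [y] into one in [y ^+ Q]. *)
  rewrite [LHS]psiD -[psi (a * u ^+ Q * y)]psi_frob -psiD; congr psi.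
  by rewrite !exprMn -exprM mulnn; ring.
under eq_bigr => u _ do rewrite psi_orthogonality //.
rewrite (bigID (fun u => a ^+ Q * u ^+ (Q ^ 2) + a * u == 0)) /=.
rewrite [X in _ + X]big1 ?addr0; last by move=> u /negPf ->; rewrite mulr0.
rewrite mulnC natrM mulr_natl -[RHS]sumr_const; apply: eq_big => // u uP.
rewrite uP psi_trace0 ?mul1r //.
exact/frob_opp_of_root/eqP.
Qed.

Variable c : F.
Hypotheses (c_neq0 : c != 0) (cQ : c ^+ Q = - c).

(** If [a = c y ^ (Q + 1)], scaling [u] by [y^-1] turns the equation into [u ^ (Q ^ 2) = u].
    Conversely, a nonzero root [u] forces [a u ^ (Q + 1) / c], and hence [a / c], to be a
    [(Q + 1)]-th power. *)
Let ker_card a : a != 0 ->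
  #|[pred u : F | a ^+ Q * u ^+ (Q ^ 2) + a * u == 0]| =
  (if ((a / c) ^+ (#|F|.-1 %/ Q.+1) == 1)%R then Q ^ 2 else 1)%N.
Proof.
move=> a0; case: ifP => [/eqP|] ac.
  have [y yP] := finField_power (mulf_neq0 a0 (invr_neq0 c_neq0)) dvdn_succQ ac.
  have y0 : y != 0.
    apply/eqP => y0; move/eqP: yP; rewrite y0 expr0n /= eq_sym mulf_eq0.
    by rewrite (negPf a0) invr_eq0 (negPf c_neq0).
  have aE : a = c * y ^+ Q.+1 by rewrite yP mulrC divfK.
  rewrite -[RHS]card_fixed_sqr -!sum1_card.
  rewrite (reindex_inj (mulfI (invr_neq0 y0))); apply: eq_bigl => u.
  rewrite !inE /=.
  have -> : a ^+ Q * (y^-1 * u) ^+ (Q ^ 2) + a * (y^-1 * u) =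
      c * y ^+ Q * (u - u ^+ (Q ^ 2)).
    rewrite aE !exprMn cQ -exprM mulSn mulnn exprD exprVn exprSr.
    have := expf_neq0 (Q ^ 2) y0; move: (y ^+ Q) (y ^+ (Q ^ 2)) (u ^+ (Q ^ 2)) => A B C B0.
    by field; rewrite y0 B0.
  by rewrite !mulf_eq0 expf_eq0 (negPf c_neq0) (negPf y0) andbF subr_eq0 eq_sym.
apply/eqP; rewrite (cardD1 0) inE mulr0 expr0n (gtn_eqF Q2_gt0) mulr0.
rewrite addr0 eqxx eqSS; apply/eqP; apply: eq_card0 => u; rewrite !inE.
apply/negP => /andP[u0 /eqP/frob_opp_of_root uP].
move/negP: ac; apply; apply/eqP.
pose t := a * u ^+ Q.+1 / c.
have t0 : t != 0 by rewrite !mulf_neq0 ?invr_eq0 ?expf_neq0.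
(* [t] lies in the subfield of order [Q], whose nonzero elements are [Q.+1]-th powers. *)
have t1 : t ^+ Q.-1 = 1.
  apply: (mulfI t0); rewrite -exprS prednK // /t expr_div_n uP cQ mulr1.
  by rewrite invrN mulrNN.
have : (t / u ^+ Q.+1) ^+ (#|F|.-1 %/ Q.+1) = 1.
  rewrite expr_div_n -exprM [(Q.+1 * _)%N]mulnC divnK ?dvdn_succQ //.
  rewrite finField_expf_pred // divr1 q1_divS exprM t1 expr1n //.
by move=> <-; congr (_ ^+ _); rewrite /t mulrAC mulrK // unitfE expf_neq0.
Qed.

(* The test [t ^+ (#|F|.-1 %/ d) == 1] says that [t] is a [d]-th power. *)
Lemma powersum_succQ a : a != 0 ->
  G a = (- Q%:R) ^+ g *
    (1 - (Q.+1)%:R * ((a / c) ^+ (#|F|.-1 %/ Q.+1) == 1)%:R).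
Proof.
move=> a0.
pose S := \sum_(y | (y != 0) && (y ^+ (#|F|.-1 %/ Q.+1) == 1)) psi (a * y).
have GE : G a = 1 + (Q.+1)%:R * S.
  rewrite powersum_nz // (sum_power_fibers (fun y => psi (a * y))) //.
  by rewrite (gcdn_idPl dvdn_succQ) mulr_natl.
have SA : S \in Aint by apply: rpred_sum => y _; apply: psi_Aint.
have sgnsq n : ((- Q%:R) ^+ n) ^+ 2 = (Q ^ (2 * n))%:R :> algC.
  by rewrite exprAC sqrrN -!natrX -expnM.
set i := (_ == 1).
have [B BA BE] := oppX_congr1 Q (g + i).
(* As [i] is 0 or 1, [1 - (Q + 1) i = (- Q) ^ i]. The claimed value is thus a power of [- Q], so it
   is 1 modulo [Q + 1], as [G a] is. *)
have -> : (- Q%:R) ^+ g * (1 - (Q.+1)%:R * i%:R) = (- Q%:R) ^+ (g + i) :> algC.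
  case: i {B BA BE}; last by rewrite mulr0 subr0 mulr1 addn0.
  by rewrite addn1 exprSr mulr1 -natr1; congr (_ * _); ring.
apply: (Aint_eq_of_sqr_eq _ SA BA GE BE); first by lia.
rewrite G_sqr ker_card // -/i sgnsq cardF; congr (_%:R).
by case: i {B BA BE}; rewrite ?addn1 ?addn0 ?muln1 // -expnD; congr (_ ^ _)%N; lia.
Qed.

(** Summing over [w != 0] after [x -> x w ^ e] replaces [a x ^ d] by [a x ^ d w ^ (Q + 1)]. The sum
    becomes an average of known values of [G], and it remains to count how often [a x ^ d / c] is a
    [(Q + 1)]-th power. *)
Lemma powersum_semiprimitive d a : (d %| Q.+1)%N -> a != 0 ->
  powersum psi d a = (- Q%:R) ^+ g *
    (1 - d%:R * ((a / c) ^+ (#|F|.-1 %/ d) == 1)%:R).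
Proof.
move=> dQ a0.
have d0 : (0 < d)%N by apply: dvdn_gt0 dQ.
have q1_gt0 : (0 < #|F|.-1)%N.
  by have [z] := finField_prim_root F; apply: prim_order_gt0.
pose e := (Q.+1 %/ d)%N; have deE : (d * e = Q.+1)%N by rewrite mulnC divnK.
have q1n0 : (#|F|.-1)%:R != 0 :> algC by rewrite pnatr_eq0; lia.
have nzC : #|[pred x : F | x != 0]| = #|F|.-1 := finField_card_nz F.
pose cnt := #|[pred x : F | (x != 0) && ((a * x ^+ d / c) ^+ (#|F|.-1 %/ Q.+1) == 1)]|.
(* There is no such [x] unless [a / c = y ^ d] for some [y]; then [x -> y^-1 x] turns the condition
   into [x ^ (d M) = 1]. *)
have cntE : (cnt * Q.+1 = d * #|F|.-1 * ((a / c) ^+ (#|F|.-1 %/ d) == 1)%R)%N.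
  pose M := (#|F|.-1 %/ Q.+1)%N; have ME : (M * Q.+1 = #|F|.-1)%N.
    by rewrite divnK ?dvdn_succQ.
  have MeE : (#|F|.-1 %/ d = M * e)%N.
    by rewrite -ME -deE mulnCA mulKn.
  have dq : (d %| #|F|.-1)%N := dvdn_trans dQ dvdn_succQ.
  have ac0 : a / c != 0 by rewrite mulf_neq0 ?invr_eq0.
  rewrite -/M in cnt *.
  case: eqP => [ac1 | acN1]; last first.
    rewrite muln0 (_ : cnt = 0%N) //; apply: eq_card0 => x; rewrite !inE.
    apply/negP => /andP[x0 /eqP xM]; apply: acN1.
    have : (a * x ^+ d / c) ^+ (M * e) = 1 by rewrite exprM xM expr1n.
    rewrite mulrAC exprMn -exprM -MeE [(d * _)%N]mulnC divnK //.
    by rewrite finField_expf_pred // mulr1.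
  have [y yP] := finField_power ac0 dq ac1.
  have y0 : y != 0.
    by apply: contraNneq ac0 => y0; rewrite -yP y0 expr0n gtn_eqF.
  suff -> : cnt = (d * M)%N by rewrite muln1 -mulnA ME.
  have dMq : (d * M %| #|F|.-1)%N by rewrite -ME -deE mulnC dvdn_mul // dvdn_mulr.
  rewrite -[RHS](finField_count_unity dMq) /cnt -!sum1_card.
  rewrite [LHS](reindex_inj (mulfI (invr_neq0 y0))); apply: eq_bigl => x.
  rewrite !inE /= mulf_eq0 invr_eq0 (negPf y0) /=.
  rewrite mulrAC -yP -exprMn mulVKf // -exprM.
  case: (eqVneq x 0) => // ->; rewrite expr0n gtn_eqF 1?eq_sym ?oner_eq0 //.
  exact: dvdn_gt0 dMq.
have sumE : (#|F|.-1)%:R * (\sum_(x | x != 0) psi (a * x ^+ d)) =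
    \sum_(x | x != 0) (G (a * x ^+ d) - 1).
  transitivity (\sum_(w : F | w != 0) \sum_(x | x != 0) psi (a * (x * w ^+ e) ^+ d)).
    rewrite mulr_natl -nzC -sumr_const; apply: eq_bigr => w w0.
    have we0 : w ^+ e != 0 by rewrite expf_neq0.
    rewrite (reindex_inj (mulIf we0)) /=; apply: eq_bigl => x.
    by rewrite mulf_eq0 (negPf we0) orbF.
  rewrite exchange_big /=; apply: eq_bigr => x x0.
  rewrite powersum_nz // addrC addKr; apply: eq_bigr => w _.
  by rewrite exprMn -exprM [(e * d)%N]mulnC deE mulrA.
rewrite powersum_nz //; apply: (mulfI q1n0); rewrite mulrDr sumE.
rewrite (eq_bigr (fun x => (- Q%:R) ^+ g - 1 - (- Q%:R) ^+ g * (Q.+1)%:R *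
    ((a * x ^+ d / c) ^+ (#|F|.-1 %/ Q.+1) == 1)%:R)); last first.
  move=> x x0; rewrite powersum_succQ ?mulf_neq0 ?expf_neq0 //; ring.
rewrite sumrB sumr_const nzC -mulr_sumr -natr_sum.
rewrite -big_mkcondr sum1_card -[#|_|]/cnt.
rewrite -mulrA -[Q.+1%:R * _]natrM [(Q.+1 * _)%N]mulnC cntE !natrM -[_ *+ #|F|.-1]mulr_natr.
by ring.
Qed.

End Semiprimitive.

(** * The absolute trace and a Frobenius-invariant character *)

Section Trace.

Variables (F : finFieldType) (p s : nat).
Hypotheses (pchF : p \in [pchar F]) (cardF : #|F| = (p ^ s)%N).

Let p_prime : prime p. Proof. exact: pcharf_prime pchF. Qed.

(** The trace to the prime field, with values kept in [F] so that a character of [F] can be composed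
    with it. *)
Definition abs_trace (x : F) : F := \sum_(i < s) x ^+ (p ^ i).

Lemma abs_traceD : {morph abs_trace : x y / x + y}.
Proof.
by move=> x y; rewrite /abs_trace -big_split; apply: eq_bigr => i _; apply: exprpXD.
Qed.

Lemma abs_trace_frob l x : abs_trace (x ^+ (p ^ l)) = abs_trace x.
Proof.
elim: l => [|l <-]; first by rewrite expr1.
rewrite expnSr exprM; move: (x ^+ _) => y {x}.
rewrite /abs_trace; case sE : s => [|s']; first by rewrite !big_ord0.
rewrite big_ord_recr [RHS]big_ord_recl /= addrC; congr (_ + _).
  by rewrite -exprM -expnS -sE -cardF expf_card.
by apply: eq_bigr => i _; rewrite -exprM -expnS.
Qed.

(** The trace is a nonzero polynomial of degree at most [p ^ (s - 1)], too small to vanish on all of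
    [F]. *)
Lemma exists_abs_trace_neq0 : exists x, abs_trace x != 0.
Proof.
have s_gt0 : (0 < s)%N.
  by have := finNzRing_gt1 F; rewrite cardF; case: (s).
pose P : {poly F} := \sum_(i < s) 'X^(p ^ i).
have P1 : P`_1 = 1.
  rewrite /P coef_sum (bigD1 (Ordinal s_gt0)) //= coefXn eqxx big1 ?addr0 // => i i0.
  rewrite coefXn; case: eqP => // /esym/eqP; rewrite -(expn0 p) eqn_exp2l ?prime_gt1 //.
  by move=> /eqP iE; case/eqP: i0; apply: val_inj.
have P0 : P != 0 by apply/eqP => P0; move/eqP: P1; rewrite P0 coef0 eq_sym oner_eq0.
have sizeP : (size P <= (p ^ s.-1).+1)%N.
  apply: leq_trans (size_sum _ _ _) _; apply/bigmax_leqP => i _.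
  rewrite size_polyXn ltnS leq_exp2l ?prime_gt1 // -ltnS prednK //.
apply/existsP; rewrite -negb_forall; apply/negP => /forallP tr0.
have : (size (enum F) < size P)%N.
  apply: max_poly_roots P0 _ (enum_uniq _); apply/allP => x _.
  apply/rootP; rewrite /P horner_sum -[RHS](eqP (tr0 x)).
  by apply: eq_bigr => i _; rewrite hornerXn.
rewrite -cardE cardF => /leq_trans/(_ sizeP); rewrite ltnS leq_exp2l ?prime_gt1 //.
by rewrite -ltnS prednK // ltnn.
Qed.

(** In each block of [2 l] consecutive terms, those with indices [i] and [l + i] cancel. *)
Lemma abs_trace_eq0 l g x : s = (2 * l * g)%N -> x ^+ (p ^ l) = - x -> abs_trace x = 0.
Proof.
rewrite /abs_trace => -> xl; elim: g => [|g IH]; first by rewrite muln0 big_ord0.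
rewrite mulnS addnC big_split_ord /= IH add0r.
have: (x ^+ (p ^ (2 * l * g))) ^+ (p ^ l) = - x ^+ (p ^ (2 * l * g)).
  by rewrite exprAC xl (exprpXN _ _ pchF).
under eq_bigr do rewrite expnD exprM.
move: (x ^+ _) => y yl; rewrite mul2n -addnn big_split_ord /= -big_split big1 // => i _.
by rewrite /= expnD exprM yl (exprpXN _ _ pchF) subrr.
Qed.

Lemma exists_trace_char (l g : nat) : s = (2 * l * g)%N ->
  exists psi : F -> algC,
    [/\ {morph psi : y z / y + z >-> y * z}, psi 0 = 1, exists x, psi x != 1,
      forall x, psi (x ^+ (p ^ l)) = psi x &
      forall x, x ^+ (p ^ l) = - x -> psi x = 1].
Proof.
move=> sE; have [x0 tr0] := exists_abs_trace_neq0.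
have [chi [chiD chi0 chi_x0]] := exists_add_char tr0.
have trace0 : abs_trace 0 = 0 by apply: (addrI (abs_trace 0)); rewrite -abs_traceD !addr0.
exists (chi \o abs_trace); split => /=.
- by move=> y z /=; rewrite abs_traceD chiD.
- by rewrite trace0.
- by exists x0.
- by move=> x; rewrite abs_trace_frob.
by move=> x xl; rewrite (abs_trace_eq0 sE xl).
Qed.

End Trace.

(** * Root-of-unity sums and the numbers [I] *)

Lemma sum_root_of_unity (M : nat) (w : algC) (e : nat) : M.-primitive_root w ->
  \sum_(k < M) (w ^+ e) ^+ k = M%:R * (M %| e)%:R.
Proof.
move=> wP; case: dvdnP => [[c ->] | eN].
  under eq_bigr => k _ do rewrite mulnC exprM (prim_expr_order wP) !expr1n.
  by rewrite sumr_const card_ord mulr1.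
have we : w ^+ e != 1 by rewrite -(prim_order_dvd wP); apply/dvdnP.
rewrite mulr0; have := subrX1 (w ^+ e) M.
rewrite -exprM mulnC exprM (prim_expr_order wP) expr1n subrr => /esym/eqP.
by rewrite mulf_eq0 subr_eq0 (negPf we) => /eqP.
Qed.

(** The index type ['I_m] may exceed [d] because [Icount] draws all its [j_i] from one common
    ordinal. *)
Lemma sum_root_of_unity_nz (M d : nat) (w : algC) (k m : nat) :
  M.-primitive_root w -> (d %| M)%N -> (d <= m)%N ->
  \sum_(j < m | (1 <= j)%N && (j <= d.-1)%N) (w ^+ (M %/ d)) ^+ (k * j) =
  d%:R * (d %| k)%:R - 1.
Proof.
move=> wP dM dm.
have d0 : (0 < d)%N := dvdn_gt0 (prim_order_gt0 wP) dM.
have wdP := dvdn_prim_root wP dM.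
rewrite -(sum_root_of_unity k wdP) [X in _ = X - 1](bigD1 (Ordinal d0)) //= expr0.
rewrite [1 + _]addrC addrK.
under [RHS]eq_bigl => i do rewrite -val_eqE /= -lt0n.
rewrite (big_ord_widen_cond _ (fun j => 0 < j)%N (fun j => (w ^+ (M %/ d) ^+ k) ^+ j) dm).
by apply: eq_big => j; [rewrite -[d in RHS](prednK d0) ltnS | rewrite exprM].
Qed.

Lemma int_divr_nat (N M : nat) : (0 < M)%N ->
  ((N%:R / M%:R : rat) \is a Num.int) = (M %| N)%N.
Proof.
move=> M0; have M0' : (M%:R : rat) != 0 by rewrite pnatr_eq0 -lt0n.
apply/idP/idP => [/intrP[z /eqP] | /dvdnP[c ->]]; last first.
  by rewrite natrM mulfK // rpred_nat.
rewrite (can2_eq (divfK M0') (mulfK M0')) => /eqP zE.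
have {}zE : Posz N = z * Posz M.
  by apply: (@intr_inj rat); rewrite rmorphM.
by apply/dvdnP; exists `|z|%N; rewrite -[LHS]/(`|Posz N|%N) zE abszM.
Qed.

(* [d [d | k] - 1] is the sum of the [k]-th powers of the nontrivial [d]-th roots of
   unity; expanding the product leaves only the tuples with integral [sum_i j_i / d_i]. *)
Lemma sum_prod_Icount (v : seq nat) (M : nat) : (0 < M)%N ->
  all (fun d => d %| M)%N v ->
  \sum_(k < M) \prod_(d <- v) (d%:R * (d %| k)%:R - 1) = (M * Icount v)%:R :> algC.
Proof.
move=> M0 /allP vM; have [w wP] := C_prim_root_exists M0.
pose m := \max_(x <- v) x.
have nthM (i : 'I_(size v)) : (nth 0%N v i %| M)%N by apply: vM; rewrite mem_nth.
pose A (i : 'I_(size v)) (j : 'I_m) := (1 <= j)%N && (j <= (nth 0%N v i).-1)%N.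
transitivity (\sum_(f : {ffun 'I_(size v) -> 'I_m} | f \in family A)
    \sum_(k < M) (w ^+ (\sum_(i < size v) (M %/ nth 0%N v i) * f i)%N) ^+ k).
  rewrite exchange_big; apply: eq_bigr => k _ /=.
  rewrite (big_nth 0%N) big_mkord.
  transitivity (\prod_(i < size v) \sum_(j | A i j)
      (w ^+ (M %/ nth 0%N v i)) ^+ (k * j)).
    apply: eq_bigr => i _; rewrite (sum_root_of_unity_nz k wP (nthM i)) //.
    by rewrite /m (big_nth 0%N) big_mkord; apply: leq_bigmax.
  rewrite bigA_distr_big_dep; apply: eq_bigr => f _.
  rewrite -exprM big_distrl expr_sum; apply: eq_bigr => i _ /=.
  by rewrite -exprM mulnA mulnAC.
under eq_bigr => f _ do rewrite sum_root_of_unity //.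
rewrite -mulr_sumr -natr_sum natrM; congr (_ * _%:R).
rewrite -big_mkcondr sum1_card /Icount; apply: eq_card => f; rewrite !inE.
rewrite -[_ \in _]/((f \in family A) &&
  (M %| \sum_(i < size v) (M %/ nth 0%N v i) * f i)%N).
congr (_ && _).
rewrite -int_divr_nat // natr_sum mulr_suml; congr (_ \is a Num.int).
apply: eq_bigr => i _; have d0 : (0 < nth 0%N v i)%N := dvdn_gt0 M0 (nthM i).
have d0' : ((nth 0%N v i)%:R : rat) != 0 by rewrite pnatr_eq0 -lt0n.
have e0 : ((M %/ nth 0%N v i)%:R : rat) != 0.
  by rewrite pnatr_eq0 -lt0n divn_gt0 // dvdn_leq.
by rewrite -{2}(divnK (nthM i)) !natrM; field; rewrite d0' e0.
Qed.

(** * Counting *)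

(** In [sum_prod_Icount] with [M = D], the term [k = 0] is [(D - 1) ^ r] and each of the other
    [D - 1] terms is [(-1) ^ r]. *)
Lemma Icount_nseq (r D : nat) : (0 < D)%N ->
  (Icount (nseq r D))%:R =
  ((D%:R - 1) ^+ r + (-1) ^+ r * (D%:R - 1)) / D%:R :> algC.
Proof.
move=> D0; have D0' : D%:R != 0 :> algC by rewrite pnatr_eq0 -lt0n.
have allD : all (fun d => d %| D)%N (nseq r D) by rewrite all_nseq dvdnn orbT.
apply: (mulfI D0'); rewrite -natrM -(sum_prod_Icount D0 allD) mulrC divfK //.
under eq_bigr do rewrite big_nseq iter_mulr_1.
rewrite (bigD1 (Ordinal D0)) //= dvdn0 mulr1; congr (_ + _).
rewrite (eq_bigr (fun _ => (-1) ^+ r)); last first.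
  move=> k; rewrite -val_eqE /= => k0.
  by rewrite gtnNdvd ?lt0n // mulr0 sub0r.
have -> : D%:R - 1 = D.-1%:R :> algC by rewrite -(prednK D0) -natr1 addrK.
by rewrite sumr_const mulr_natr cardC1 card_ord.
Qed.

(** For a generator [z], the power [z ^ k] passes the test for [d] exactly when [d] divides [k]. *)
Lemma sum_nz_prod_Icount (F : finFieldType) (v : seq nat) :
  all (fun d => d %| #|F|.-1)%N v ->
  \sum_(t : F | t != 0) \prod_(d <- v) (d%:R * (t ^+ (#|F|.-1 %/ d) == 1)%:R - 1)
    = (#|F|.-1 * Icount v)%:R :> algC.
Proof.
move=> vq; have [z zP] := finField_prim_root F; have q0 := prim_order_gt0 zP.
rewrite (eq_bigl _ _ (@finField_nz_unity F)) (sum_unity_root _ zP).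
rewrite -(sum_prod_Icount q0 vq); apply: eq_bigr => k _; apply: eq_big_seq => d dv.
have dq : (d %| #|F|.-1)%N := allP vq d dv.
have e0 : (0 < #|F|.-1 %/ d)%N by rewrite (divn_gt0 _ (dvdn_gt0 q0 dq)) (dvdn_leq q0 dq).
rewrite -exprM -(prim_order_dvd zP) -{1}(divnK dq) [(k * _)%N]mulnC.
by rewrite dvdn_pmul2l.
Qed.

Lemma sum_set_by_card (T : finType) (V : nmodType) (f : {set T} -> V) :
  \sum_J f J = \sum_(0 <= r < #|T|.+1) \sum_(J : {set T} | #|J| == r) f J.
Proof.
rewrite big_mkord (partition_big (fun J : {set T} => inord #|J| : 'I_#|T|.+1) xpredT) //=.
apply: eq_bigr => r _; apply: eq_bigl => J.
by rewrite -val_eqE /= inordK // ltnS max_card.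
Qed.

(** Orthogonality detects the zeros. The predicate [P] lets one statement serve both counts, over
    all of [F] and over its nonzero elements. *)
Lemma count_zeros_by_char (F : finFieldType) (psi : F -> algC) (n : nat)
    (m : 'I_n -> nat) (P : pred F) :
  {morph psi : y z / y + z >-> y * z} -> psi 0 = 1 -> (exists x, psi x != 1) ->
  (#|F|)%:R * (#|[set x : {ffun 'I_n -> F} |
      (x \in ffun_on P) && (\sum_i x i ^+ m i == 0)]|)%:R =
  \sum_a \prod_i \sum_(y | P y) psi (a * y ^+ m i).
Proof.
move=> psiD psi0 psi1; under eq_bigr do rewrite bigA_distr_big.
rewrite exchange_big /= (eq_bigr (fun x : {ffun 'I_n -> F} =>
   if \sum_i x i ^+ m i == 0 then (#|F|)%:R else 0)); last first.
  move=> x _; rewrite -(psi_orthogonality psiD psi0 psi1); apply: eq_bigr => a _.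
  by rewrite -(psi_sum psiD psi0) -mulr_sumr mulrC.
rewrite -big_mkcondr sumr_const mulr_natr; congr (_ *+ _).
by apply: eq_card => x; rewrite inE.
Qed.

Lemma Nsol_complement (F : finFieldType) (n : nat) (b : F) (k : nat)
    (kk mm : 'I_n -> nat) (k0 : nat) :
  (0 < k)%N -> (forall i, (0 < kk i)%N) ->
  (k0 %| k)%N -> (forall i, (k0 %| kk i)%N) -> ~ (exists y : F, y ^+ k0 = b) ->
  (Nsol b k kk mm + #|[set x : {ffun 'I_n -> F} |
      (x \in ffun_on [pred y : F | y != 0%R]) && (\sum_i x i ^+ mm i == 0)%R]| =
   #|[set x : {ffun 'I_n -> F} |
      (x \in ffun_on xpredT) && (\sum_i x i ^+ mm i == 0)%R]|)%N.
Proof.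
move=> k_gt0 kk_gt0 k0k k0kk bN.
rewrite /Nsol -[RHS](cardsID [set x | x \in ffun_on [pred y : F | y != 0%R]]) addnC.
have onT (x : {ffun 'I_n -> F}) : x \in ffun_on xpredT by apply/ffun_onP.
congr (_ + _)%N; apply: eq_card => x; rewrite ?(in_setD, in_setI, in_set) onT andTb.
  by rewrite andbC.
case: (boolP (x \in ffun_on _)) => /= [/ffun_onP xnz | /ffun_onP xz].
  apply/negP => /eqP Sx; apply: bN.
  (* Since [k0] divides all the exponents, solving the equation for [b] exhibits a [k0]-th root of
     it. *)
  exists ((\sum_i x i ^+ mm i) ^+ (k %/ k0) / \prod_i x i ^+ (kk i %/ k0)).
  rewrite expr_div_n -prodrXl -exprM divnK // Sx.
  under [X in _ / X]eq_bigr do rewrite -exprM divnK //.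
  by rewrite mulfK //; apply/prodf_neq0 => i _; rewrite expf_neq0 //; apply: xnz.
have [i /eqP xi] : exists i, x i == 0.
  apply/existsP; apply: contra_notT xz; rewrite negb_exists => /forallP xnz i.
  exact: xnz.
rewrite [X in b * X](bigD1 i) //= xi expr0n gtn_eqF // mul0r mulr0.
by rewrite expf_eq0 k_gt0.
Qed.

Theorem theorem2 (F : finFieldType) (p s : nat) (hp : prime p)
  (hchar : p \in [pchar F]) (hq : #|F| = (p ^ s)%N)
  (n : nat) (hn : (2 <= n)%N) (b : F) (hb : b != 0)
  (k : nat) (kk mm : 'I_n -> nat)
  (hk : (0 < k)%N) (hkk : forall i, (0 < kk i)%N) (hmm : forall i, (0 < mm i)%N)
  (d : 'I_n -> nat) (hd : forall j, d j = gcdn (mm j) (#|F|).-1)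
  (D : nat) (hDdef : D = \big[lcmn/1%N]_(j < n) d j)
  (k0 : nat) (hk0 : k0 = gcdn (gcdn k (\big[gcdn/0%N]_(j < n) kk j)) (#|F|).-1)
  (hbk0 : ~ exists y : F, y ^+ k0 = b)
  (hD2 : (2 < D)%N)
  (l : nat) (hl : (0 < l)%N) (hDl : (D %| p ^ l + 1)%N)
  (hlmin : forall l' : nat, (0 < l')%N -> (D %| p ^ l' + 1)%N -> (l <= l')%N) :
  let q : algC := (#|F|)%:R in
  let N : algC := (Nsol b k kk mm)%:R in
  (2 * l %| s)%N /\
  N = q ^+ n.-1 - ((q - 1) ^+ n + (-1) ^+ n * (q - 1)) / q
      - (-1) ^+ n * (q - 1) *
        \sum_(2 <= r < n) (-1) ^+ ((r * s) %/ (2 * l)) * sqrtC q ^+ (r - 2)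
           * \sum_(J : {set 'I_n} | #|J| == r) (Icount [seq d j | j <- enum J])%:R
  /\ ((forall j, d j = D) ->
      N = q ^+ n.-1 - ((q - 1) ^+ n + (-1) ^+ n * (q - 1)) / q
      - (-1) ^+ n * (q - 1) *
        \sum_(2 <= r < n) (-1) ^+ ((r * s) %/ (2 * l)) * sqrtC q ^+ (r - 2)
           * 'C(n, r)%:R * (((D%:R - 1) ^+ r + (-1) ^+ r * (D%:R - 1)) / D%:R)).
Proof.
have dq j : (d j %| #|F|.-1)%N by rewrite hd dvdn_gcdr.
have dD j : (d j %| D)%N by rewrite hDdef (biglcmn_sup j).
have d_gt0 j : (0 < d j)%N by rewrite hd gcdn_gt0 hmm.
have Dq : (D %| (p ^ s).-1)%N by rewrite -hq hDdef; apply/dvdn_biglcmP => j _.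
have ls := double_dvdn_of_min_exp hD2 hl hDl hlmin Dq.
move=> q N; split=> //.
have [g sE] : exists g, s = (2 * l * g)%N.
  by move/dvdnP: ls => [g ->]; exists g; rewrite mulnC.
pose Q := (p ^ l)%N.
have cardF : #|F| = (Q ^ (2 * g))%N by rewrite hq sE -expnM; congr (_ ^ _)%N; ring.
have [psi [psiD psi0 psi1 psiQ psiT]] := exists_trace_char hchar hq sE.
have [c c0 cQ] := exists_frob_opp hchar hl (erefl Q) cardF.
pose R : algC := (Q ^ g)%:R.
have qE : q = R ^+ 2 by rewrite /q cardF /R -natrX -expnM mulnC.
have sqrtq : sqrtC q = R by rewrite qE sqrCK ?ler0n.
have q_neq0 : q != 0.
  by rewrite /q pnatr_eq0 -lt0n; apply: ltnW; apply: finNzRing_gt1.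
have q1E : (#|F|.-1)%:R = q - 1.
  by rewrite /q -(prednK (ltnW (finNzRing_gt1 F))) -natr1 addrK.
pose f j (t : F) : algC := (d j)%:R * (t ^+ (#|F|.-1 %/ d j) == 1)%:R - 1.
(* The sign turns the factor [1 - d [...]] of the power sum into [f]. *)
pose kap : algC := - (- Q%:R) ^+ g.
have powE j t : t != 0 -> powersum psi (mm j) (c * t) = kap * f j t.
  move=> t0; have ct0 : c * t != 0 by rewrite mulf_neq0.
  rewrite powersum_nz // (sum_power_gcd (fun y => psi (c * t * y))) // -hd -powersum_nz //.
  rewrite (powersum_semiprimitive hchar hl (erefl Q) cardF psiD psi0 psi1
    psiQ psiT c0 cQ) //.
    by rewrite mulrAC divff // mul1r /kap /f; ring.
  by apply: dvdn_trans (dD j) _; rewrite -addn1.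
(* [T J] is the contribution of [J] when the product of the factors [kap * f i t - 1] is expanded
   and summed over [t != 0]. *)
pose T (J : {set 'I_n}) : algC :=
  kap ^+ #|J| * (-1) ^+ (n - #|J|) * ((q - 1) * (Icount [seq d j | j <- enum J])%:R).
have TE (J : {set 'I_n}) :
    \sum_(t | t != 0) \prod_i (if i \in J then kap * f i t else -1) = T J.
  transitivity (\sum_(t | t != 0) kap ^+ #|J| * (-1) ^+ (n - #|J|) *
      \prod_(i in J) f i t).
    apply: eq_bigr => t _; rewrite (bigID (mem J)) /=.
    rewrite (eq_bigr (fun i => kap * f i t)); last by move=> i ->.
    rewrite [X in _ * X](eq_bigr (fun _ => -1)); last by move=> i /negPf ->.
    rewrite big_split /= !prodr_const mulrAC; congr (_ * _ ^+ _ * _).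
    have := cardsC J; rewrite card_ord => cJ.
    transitivity #|~: J|; last by rewrite -(addKn #|J| #|~: J|) cJ.
    by apply: eq_card => i; rewrite inE.
  rewrite -mulr_sumr; congr (_ * _).
  rewrite -q1E -natrM -sum_nz_prod_Icount; last by apply/allP => _ /mapP[j _ ->].
  by apply: eq_bigr => t _; rewrite big_map big_enum.
have sum_c (g0 : F -> algC) : \sum_(a | a != 0) g0 a = \sum_(t | t != 0) g0 (c * t).
  rewrite (reindex_inj (mulfI c0)); apply: eq_bigl => t.
  by rewrite mulf_eq0 (negPf c0).
(* Complete power sums have no [-1] to expand, so only the full index set occurs; [a = 0] gives
   [q ^ n]. *)
have Zall : q * (#|[set x : {ffun 'I_n -> F} | (x \in ffun_on xpredT)
    && (\sum_i x i ^+ mm i == 0)]|)%:R = q ^+ n + T setT.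
  rewrite /q (count_zeros_by_char _ _ psiD psi0 psi1) (bigD1 0) //=; congr (_ + _).
    under eq_bigr => i _ do rewrite -/(powersum psi _ 0) powersum0 //.
    by rewrite prodr_const card_ord.
  rewrite -TE sum_c; apply: eq_bigr => t t0; apply: eq_bigr => i _.
  by rewrite inE -powE.
(* Leaving out [x = 0] lowers each power sum by 1, so every subset contributes. *)
have Znz : q * (#|[set x : {ffun 'I_n -> F} | (x \in ffun_on [pred y : F | y != 0])
    && (\sum_i x i ^+ mm i == 0)]|)%:R = (q - 1) ^+ n + \sum_J T J.
  rewrite /q (count_zeros_by_char _ _ psiD psi0 psi1) (bigD1 0) //=; congr (_ + _).
    rewrite -/q -q1E (eq_bigr (fun _ => #|F|.-1%:R)) ?prodr_const ?card_ord // => i _.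
    under eq_bigr do rewrite mul0r psi0.
    by rewrite sumr_const finField_card_nz.
  under [RHS]eq_bigr do rewrite -TE.
  rewrite exchange_big /= sum_c; apply: eq_bigr => t t0.
  rewrite -bigA_distr; apply: eq_bigr => i _.
  by rewrite -powE // powersum_nz // /= [1 + _]addrC addrK.
have NE : q * N = q ^+ n - (q - 1) ^+ n - (\sum_J T J - T setT).
  have k0k : (k0 %| k)%N by rewrite hk0 (dvdn_trans (dvdn_gcdl _ _)) ?dvdn_gcdl.
  have k0kk i : (k0 %| kk i)%N.
    rewrite hk0 (dvdn_trans (dvdn_gcdl _ _)) // (dvdn_trans (dvdn_gcdr _ _)) //.
    by rewrite (biggcdn_inf i).
  have := Nsol_complement mm hk hkk k0k k0kk hbk0.
  move/(congr1 (fun m => q * m%:R)); rewrite natrD mulrDr Zall Znz -/N.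
  by move/(canRL (addrK _)) ->; ring.
have main : N = q ^+ n.-1 - ((q - 1) ^+ n + (-1) ^+ n * (q - 1)) / q
      - (-1) ^+ n * (q - 1) *
        \sum_(2 <= r < n) (-1) ^+ ((r * s) %/ (2 * l)) * sqrtC q ^+ (r - 2)
           * \sum_(J : {set 'I_n} | #|J| == r) (Icount [seq d j | j <- enum J])%:R.
  pose S r : algC := \sum_(J : {set 'I_n} | #|J| == r) (Icount [seq d j | j <- enum J])%:R.
  pose eps r : algC := (-1) ^+ ((r * s) %/ (2 * l)).
  (* The empty tuple counts once; this term later joins [(q - 1) ^ n] in the closed fraction. *)
  have T0 : T set0 = (-1) ^+ n * (q - 1).
    rewrite /T cards0 subn0 enum_set0 -[map _ _]/(nseq 0 1%N) Icount_nseq //.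
    by rewrite !expr0 subrr mulr0 addr0 divr1 mulr1 mul1r.
  (* Singletons vanish, since [j / d] is never an integer for [0 < j < d]; hence the sum starts at
     2. *)
  have T1 (J : {set 'I_n}) : #|J| == 1%N -> T J = 0.
    move=> /cards1P[x ->]; rewrite /T enum_set1 -[map _ _]/(nseq 1 (d x)).
    by rewrite Icount_nseq // !expr1 mulN1r subrr mul0r !mulr0.
  (* As [s = 2 l g], the exponent [r s / 2 l] is [g r], the sign exponent coming from
     [((-1) ^ g) ^ r] in [kap ^ r]. *)
  have Tr r : (r <= n)%N -> \sum_(J : {set 'I_n} | #|J| == r) T J =
      (-1) ^+ n * (q - 1) * (eps r * R ^+ r * S r).
    move=> rn; rewrite /S !mulr_sumr; apply: eq_bigr => J /eqP Jr.
    rewrite /T Jr; have -> : eps r = (-1) ^+ (g * r).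
      by rewrite /eps sE mulnC -mulnA mulKn ?muln_gt0.
    have -> : (-1) ^+ n = (-1) ^+ (n - r) * (-1) ^+ r :> algC.
      by rewrite -exprD subnK.
    have -> : kap = -1 * (-1) ^+ g * R by rewrite /kap /R natrX exprNn mulN1r mulNr.
    by rewrite !exprMn -exprM; ring.
  (* Subtracting [T setT] removes exactly the term [r = n]. *)
  have sumT : \sum_J T J - T setT =
      (-1) ^+ n * (q - 1) + (-1) ^+ n * (q - 1) * \sum_(2 <= r < n) eps r * R ^+ r * S r.
    rewrite sum_set_by_card card_ord big_nat_recr //= (big_pred1 setT); last first.
      move=> J; rewrite /= eqEcard subsetT cardsT card_ord eqn_leq.
      by rewrite (leq_trans (max_card _)) ?card_ord.
    rewrite addrK big_ltn ?(ltnW hn) // big_ltn //.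
    rewrite (big_pred1 set0) ?T0; last by move=> J; rewrite /= cards_eq0.
    rewrite big1 // add0r; congr (_ + _); rewrite mulr_sumr.
    by apply: eq_big_nat => r /andP[_ rn]; rewrite Tr // ltnW.
  apply: (mulfI q_neq0); rewrite NE sumT sqrtq.
  have -> : q ^+ n = q * q ^+ n.-1 by rewrite -exprS prednK // ltnW.
  have -> : \sum_(2 <= r < n) eps r * R ^+ r * S r =
      q * \sum_(2 <= r < n) (-1) ^+ ((r * s) %/ (2 * l)) * R ^+ (r - 2) * S r.
    rewrite mulr_sumr; apply: eq_big_nat => r /andP[r2 _].
    have -> : R ^+ r = q * R ^+ (r - 2) by rewrite qE -exprD subnKC.
    by rewrite /eps; ring.
  rewrite -/(S _); set X := \sum_(2 <= r < n) _.
  by field.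
split=> // dDD; rewrite {1}main; congr (_ - _ * _); apply: eq_big_nat => r _.
rewrite -[RHS]mulrA; congr (_ * _).
rewrite (eq_bigr (fun _ => ((D%:R - 1) ^+ r + (-1) ^+ r * (D%:R - 1)) / D%:R)); last first.
  move=> J /eqP Jr; rewrite -Icount_nseq; last by apply: ltn_trans hD2.
  congr (Icount _)%:R; rewrite -Jr cardE -(size_map d).
  by apply/all_pred1P/allP => _ /mapP[j _ ->]; rewrite /= dDD.
rewrite sumr_const mulr_natl; congr (_ *+ _).
transitivity #|[set J : {set 'I_n} | #|J| == r]|; last by rewrite card_draws card_ord.
by apply: eq_card => J; rewrite inE.
Qed.
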